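(* Let $d\ge 1$ and $n\in\mathbb{N}$, let $M\in\mathbb{C}^{d\times d}$, and denote by $m_1,\ldots,m_d\in\mathbb{C}^d$ the row vectors of $M$. Then the $n$-fold symmetric Kronecker product $S_n(M)\in\mathbb{C}^{L_n\times L_n}$ satisfies, for all $y\in\mathbb{C}^{L_n}$ and all $k=(k_1,\ldots,k_d)\in\mathbb{N}^d$ with $|k|=n$, \[ \left(S_n(M)\,y\right)_k=\frac{1}{\sqrt{k!}}\sum_{|\alpha_1|=k_1}\cdots\sum_{|\alpha_d|=k_d}\binom{k_1}{\alpha_1}\cdots\binom{k_d}{\alpha_d}\,m_1^{\alpha_1}\cdots m_d^{\alpha_d}\,\sqrt{(\alpha_1+\cdots+\alpha_d)!}\;y_{\alpha_1+\cdots+\alpha_d}, \] where the summations range over multi-indices $\alpha_1,\ldots,\alpha_d\in\mathbb{N}^d$ with $|\alpha_1|=k_1,\ldots,|\alpha_d|=k_d$, and the components of vectors in $\mathbb{C}^{L_n}$ are labelled by the multi-indices of order $n$.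
   Context: $\mathbb{N}=\{0,1,2,\ldots\}$. For a multi-index $k=(k_1,\ldots,k_d)\in\mathbb{N}^d$: $|k|=k_1+\cdots+k_d$, $k!=k_1!\cdots k_d!$, $\binom{|k|}{k}=\frac{|k|!}{k_1!\cdots k_d!}$, and for $v\in\mathbb{C}^d$, $v^k=v_1^{k_1}\cdots v_d^{k_d}$ (with $0^0=1$). Enumerations. Let $L_n=\binom{n+d-1}{n}$. Let $\ell_n=(\ell_n(1),\ldots,\ell_n(L_n))$ be the list, without repetition, of all $k\in\mathbb{N}^d$ with $|k|=n$ in reverse (i.e. decreasing) lexicographic order; e.g. for $d=2$, $\ell_2=((2,0),(1,1),(0,2))$. Let $\nu_n=(\nu_n(1),\ldots,\nu_n(d^n))$ be the redundant list of multi-indices of modulus $n$ defined recursively by $\nu_0=((0,\ldots,0))$ and $\nu_{n+1}((m-1)d^n+j)=\nu_n(j)+e_m^t$ for $m=1,\ldots,d$, $j=1,\ldots,d^n$, where $e_m$ is the $m$th standard basis vector of $\mathbb{C}^d$. For $i\in\{1,\ldots,L_n\}$ let $\sigma_n(i)=\{j\in\{1,\ldots,d^n\}:\nu_n(j)=\ell_n(i)\}$. Matrix $P_n$. With $e_1,\ldots,e_{d^n}$ the standard basis of $\mathbb{C}^{d^n}$, let $p_i=\frac{1}{\sqrt{\#\sigma_n(i)}}\sum_{j\in\sigma_n(i)}e_j$ for $i=1,\ldots,L_n$, and let $P_n$ be the $L_n\times d^n$ matrix with rows $p_1^t,\ldots,p_{L_n}^t$. Symmetric Kronecker product. $M^{n\otimes}=M\otimes\cdots\otimes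 M$ ($n$ factors, usual Kronecker product, so $M^{(n+1)\otimes}$ is the block matrix with blocks $M_{ij}M^{n\otimes}$; $M^{0\otimes}=1$), a $d^n\times d^n$ matrix. The $n$-fold symmetric Kronecker product is $S_n(M)=P_n\,M^{n\otimes}\,P_n^*\in\mathbb{C}^{L_n\times L_n}$. Labelling. For $y\in\mathbb{C}^{L_n}$ and a multi-index $k$ with $|k|=n$, $y_k$ denotes the $i$th component of $y$, where $i$ is the unique index with $\ell_n(i)=k$. *)

(* Defs.v *)
From HB Require Import structures.
From mathcomp Require Import all_boot all_order all_algebra.
From mathcomp Require Import reals complex mxtens.
From mathcomp Require Import mpoly.

Set Implicit Arguments.
Unset Strict Implicit.
Unset Printing Implicit Defensive.

Import Order.TTheory GRing.Theory Num.Theory.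
Local Open Scope ring_scope.

(* Multi-indices k in N^d are the monomials 'X_{1..d}, with |k| = mdeg k and  *)
(* e_m = U_(m). Matrix indices and positions in the lists are 0-based.        *)

Section MultiIndex.
Variable d : nat.
Implicit Types (k : 'X_{1..d}).

Definition mfact k : nat := (\prod_(i < d) (k i)`!)%N.

Section Coef.
Variable C : numClosedFieldType.

(* The multinomial coefficient |k|! / k!; the upper entry is always |k|. *)
Definition mbinom k : C := (mdeg k)`!%:R / (mfact k)%:R.

Definition mpow (v : 'rV[C]_d) k : C := \prod_(i < d) v 0 i ^+ k i.

End Coef.

Definition lex_ge : rel 'X_{1..d} :=
  fun a b => ((b : d.-tuplelexi nat) <= (a : d.-tuplelexi nat))%O.

Variable n : nat.

Definition symdim : nat := 'C(n + d - 1, n).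

Definition ell_seq : seq 'X_{1..d} :=
  sort lex_ge [seq bmnm a | a : 'X_{1..d < n.+1} <- enum predT & mdeg a == n].

Definition ell (i : 'I_symdim) : 'X_{1..d} := nth 0%MM ell_seq i.

End MultiIndex.

Fixpoint nu_seq (d n : nat) : seq 'X_{1..d} :=
  if n is n'.+1 then
    flatten [seq [seq (k + U_(m))%MM | k <- nu_seq d n'] | m <- enum 'I_d]
  else [:: 0%MM].

Definition nu (d n : nat) (j : 'I_(d ^ n)) : 'X_{1..d} := nth 0%MM (nu_seq d n) j.

Definition sigma (d n : nat) (i : 'I_(symdim d n)) : {set 'I_(d ^ n)} :=
  [set j | nu j == ell i].

Section SymKronecker.
Variables (C : numClosedFieldType) (d n : nat).

Definition symvec (i : 'I_(symdim d n)) : 'cV[C]_(d ^ n) :=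
  (sqrtC #|sigma i|%:R)^-1 *: \sum_(j in sigma i) delta_mx j 0.

Definition symP : 'M[C]_(symdim d n, d ^ n) := \matrix_i (symvec i)^T.

(* ntensmx M n is the n-fold Kronecker power M *t (M *t ...), with value 1 at *)
(* n = 0.                                                                     *)
Definition symkron (M : 'M[C]_d) : 'M[C]_(symdim d n) :=
  symP *m ntensmx M n *m map_mx Num.conj symP^T.

(* The component of y labelled by k, where |k| = n (and 0 otherwise). *)
Definition mcomp (y : 'cV[C]_(symdim d n)) (k : 'X_{1..d}) : C :=
  if [pick i | ell i == k] is Some i then y i 0 else 0.

End SymKronecker.

(* The lists are as intended: ell_seq enumerates, in decreasing order and     *)
(* without repetition, the symdim d n multi-indices of order n, so that the   *)
(* labelling is a bijection; and nu_seq has d ^ n entries.                    *)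

Lemma mem_ell_seq (d n : nat) (k : 'X_{1..d}) :
  (k \in ell_seq d n) = (mdeg k == n).
Proof.
rewrite mem_sort; apply/mapP/idP => [[a + ->]|Hk].
  by rewrite mem_filter => /andP[].
have lt_k : (mdeg k < n.+1)%N by rewrite (eqP Hk).
by exists (BMultinom lt_k) => //; rewrite mem_filter mem_enum andbT.
Qed.

Lemma ell_seq_uniq (d n : nat) : uniq (ell_seq d n).
Proof.
rewrite sort_uniq map_inj_uniq; last by move=> a b /val_inj.
by rewrite filter_uniq // enum_uniq.
Qed.

Lemma ell_seq_sorted (d n : nat) : sorted (@lex_ge d) (ell_seq d n).
Proof. by apply: sort_sorted => a b; apply: le_total. Qed.

Lemma size_ell_seq (d n : nat) : (0 < d)%N -> size (ell_seq d n) = symdim d n.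
Proof.
case: d => // d _; rewrite /symdim addnS subn1 /=.
rewrite -bin_sub ?leq_addr // addKn addnC -(card_ord_partitions d n) cardE.
pose f (t : d.+1.-tuple 'I_n.+1) : 'X_{1..d.+1} :=
  Multinom [tuple of [seq val i | i <- t]].
have fE t : mdeg (f t) = (\sum_(i <- t) i)%N by rewrite /mdeg /= big_map.
have f_inj : injective f.
  by move=> s t [] /(inj_map val_inj) /val_inj.
rewrite -(size_map f); apply: perm_size; apply: uniq_perm.
- exact: ell_seq_uniq.
- by rewrite map_inj_uniq ?enum_uniq.
move=> k; rewrite mem_ell_seq; apply/idP/mapP => [/eqP Hk|[t + ->]]; last first.
  by rewrite mem_enum inE fE.
have lt_k i : (k i < n.+1)%N.
  by rewrite ltnS -Hk mdegE (bigD1 i) //= leq_addr.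
have kE : k = f [tuple Ordinal (lt_k i) | i < d.+1].
  apply/mnmP => i; rewrite {2}/fun_of_multinom /= tnth_map tnth_mktuple.
  by [].
by exists [tuple Ordinal (lt_k i) | i < d.+1]; rewrite // mem_enum inE -fE -kE Hk.
Qed.

Lemma ell_inj (d n : nat) : (0 < d)%N -> injective (@ell d n).
Proof.
move=> d_gt0 i j /eqP.
rewrite nth_uniq ?ell_seq_uniq ?size_ell_seq //.
by move=> /eqP/val_inj.
Qed.

Lemma ell_surj (d n : nat) (k : 'X_{1..d}) :
  (0 < d)%N -> mdeg k = n -> exists i : 'I_(symdim d n), ell i = k.
Proof.
move=> d_gt0 /eqP; rewrite -mem_ell_seq => k_in.
have lt_i : (index k (ell_seq d n) < symdim d n)%N.
  by rewrite -size_ell_seq // index_mem.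
by exists (Ordinal lt_i); rewrite /ell nth_index.
Qed.

Lemma mcomp_ell (C : numClosedFieldType) (d n : nat) (y : 'cV[C]_(symdim d n))
    (i : 'I_(symdim d n)) : (0 < d)%N -> mcomp y (ell i) = y i 0.
Proof.
move=> d_gt0; rewrite /mcomp; case: pickP => [j /eqP/ell_inj -> //|/(_ i)].
by rewrite eqxx.
Qed.

Lemma size_nu_seq (d n : nat) : size (nu_seq d n) = (d ^ n)%N.
Proof.
elim: n => //= n IHn; rewrite size_flatten /shape -map_comp.
rewrite (eq_map (g := fun=> (d ^ n)%N)); last by move=> m /=; rewrite size_map.
by rewrite sumnE big_map big_enum /= sum_nat_const card_ord expnS.
Qed.

Lemma nu_seqS (d n j : nat) (m : 'I_d) : (j < d ^ n)%N ->
  nth 0%MM (nu_seq d n.+1) (m * d ^ n + j) = (nth 0%MM (nu_seq d n) j + U_(m))%MM.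
Proof.
move=> lt_j /=; set F := fun m : 'I_d => [seq (k + U_(m))%MM | k <- nu_seq d n].
have sF i : size (F i) = (d ^ n)%N by rewrite size_map size_nu_seq.
suff nthF s p : (p < size s)%N ->
    nth 0%MM (flatten (map F s)) (p * d ^ n + j) = nth 0%MM (F (nth m s p)) j.
  by rewrite nthF ?size_enum_ord // nth_ord_enum (nth_map 0%MM) // size_nu_seq.
elim: s p => // a s IHs [|p] lt_p; rewrite /= nth_cat sF ?add0n ?lt_j //.
by rewrite mulSn -addnA ltnNge leq_addr /= addKn IHs.
Qed.

(* Main.v *)
Require Import Defs.
From HB Require Import structures.
From mathcomp Require Import all_boot all_order all_algebra.
From mathcomp Require Import reals complex mxtens.
From mathcomp Require Import mpoly.
From mathcomp Require Import ring.

(** The idea is to read both sides as coefficients of one polynomial. To a row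
    vector [v] attach the linear form [linform v], that is v_1 X_1 + ... + v_d X_d,
    and let m_1, ..., m_d be the rows of M.

    A column index of the n-fold Kronecker power is a word of n letters, and
    [nu] records how often each letter occurs in it. The Kronecker power has
    the products of entries M_ab, taken letter by letter, as its entries. Hence,
    when the entries of its row j are collected according to the monomial
    X^(nu l) of their column l, the result is the product of the forms of the
    rows of M indexed by the letters of j. Since polynomials commute, that
    product only depends on k = nu j: it is the product over i of
    (linform m_i)^(k_i) ([ntensmx_linform]). The multinomial theorem
    ([linform_exp]) expands each factor, and distributing the product over
    these sums yields exactly the sum over (alpha_1, ..., alpha_d) of the
    theorem, the coefficient of X^l collecting the families of total l
    ([mcoeff_prod_linform]).

    The square roots come from the normalisation of the rows of P_n. Summing
    over all words turns the same polynomial computation into a count: the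
    fibre of [nu] over k has n! / k! elements ([card_sigma]). The entry of
    S_n(M) at (k, l) is a sum of #sigma(k) equal contributions, weighted
    by 1 / sqrt (#sigma(k) #sigma(l)); this leaves sqrt (#sigma(k) / #sigma(l)),
    which is sqrt (l! / k!) ([symkronE]). *)

Import Order.TTheory GRing.Theory Num.Theory.
Local Open Scope ring_scope.
Local Open Scope complex_scope.

(** * Factorials and powers of multi-indices *)

Lemma mfact0 (d : nat) : @mfact d 0%MM = 1%N.
Proof. by apply: big1 => i _; rewrite mnm0E. Qed.

Lemma mfact_gt0 (d : nat) (a : 'X_{1..d}) : (0 < mfact a)%N.
Proof. by apply: prodn_gt0 => i; apply: fact_gt0. Qed.

Lemma mfactU (d : nat) (a : 'X_{1..d}) (i : 'I_d) :
  mfact (a + U_(i)) = ((a i).+1 * mfact a)%N.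
Proof.
rewrite /mfact (bigD1 i) //= [in RHS](bigD1 i) //= mnmDE mnm1E eqxx addn1 factS.
rewrite mulnA; congr (_ * _)%N; apply: eq_bigr => j /negbTE ji.
by rewrite mnmDE mnm1E eq_sym ji addn0.
Qed.

Lemma mpow0 (C : numClosedFieldType) (d : nat) (v : 'rV[C]_d) : mpow v 0%MM = 1.
Proof. by apply: big1 => i _; rewrite mnm0E expr0. Qed.

Lemma mpowU (C : numClosedFieldType) (d : nat) (v : 'rV[C]_d) (a : 'X_{1..d})
    (i : 'I_d) : mpow v (a + U_(i))%MM = v 0 i * mpow v a.
Proof.
rewrite /mpow (bigD1 i) //= [in RHS](bigD1 i) //= mnmDE mnm1E eqxx addn1 exprS.
rewrite mulrA; congr (_ * _); apply: eq_bigr => j /negbTE ji.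
by rewrite mnmDE mnm1E eq_sym ji addn0.
Qed.

(** * Linear forms and the multinomial theorem *)

Definition linform {R : comNzRingType} {d : nat} (v : 'rV[R]_d) :
  {mpoly R[d]} := \sum_(i < d) v 0 i *: 'X_i.

Lemma mderiv_linform (R : comNzRingType) (d : nat) (v : 'rV[R]_d) i :
  (linform v)^`M(i) = (v 0 i)%:MP.
Proof.
rewrite /linform raddf_sum (bigD1 i) //= big1 => [|j ji].
  rewrite mderivZ mderivX mnm1E eqxx -{1}[U_(i)%MM]add0m addmK mpolyX0 scale1r.
  by rewrite addr0 alg_mpolyC.
by rewrite mderivZ mderivX mnm1E (negbTE ji) scale0r scaler0.
Qed.

Lemma mderiv_exp (R : comNzRingType) (d : nat) (f : {mpoly R[d]}) i p :
  (f ^+ p.+1)^`M(i) = (f ^+ p * f^`M(i)) *+ p.+1.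
Proof.
elim: p => [|p IHp]; first by rewrite expr1 expr0 mul1r.
rewrite exprS mderivM IHp mulrnAr mulrA -exprS [_ *+ p.+2]mulrS.
by rewrite [_^`M(i) * _]mulrC.
Qed.

(** The multinomial theorem, one coefficient at a time. Differentiating in X_i
    lowers the exponent of the form: comparing the coefficients of X^b in
    the derivative of (linform v)^(p+1) gives
    (b_i + 1) c_(p+1, b + e_i) = (p + 1) v_i c_(p, b), which is the recursion
    satisfied by p! v^a / a!. The induction is run on the equation multiplied
    by a!, where no division occurs. *)
Lemma mcoeff_linform_exp (C : numClosedFieldType) (d : nat) (v : 'rV[C]_d) p a :
  (linform v ^+ p)@_a = if mdeg a == p then mbinom C a * mpow v a else 0.
Proof.
suff H : (mfact a)%:R * (linform v ^+ p)@_a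
         = if mdeg a == p then p`!%:R * mpow v a else 0.
  have a_neq0 : (mfact a)%:R != 0 :> C by rewrite pnatr_eq0 -lt0n mfact_gt0.
  apply: (mulfI a_neq0); rewrite H /mbinom; case: eqP => [->|_]; last by rewrite mulr0.
  by rewrite [_ / _]mulrC -mulrA mulVKf.
elim: p a => [|p IHp] a.
  rewrite expr0 mcoeff1 mdeg_eq0; case: eqP => [->|_]; last by rewrite mulr0.
  by rewrite mfact0 mpow0 fact0.
have [->|/eqP a_neq0] := eqVneq a 0%MM.
  have linform0 : (linform v)@_0%MM = 0.
    rewrite /linform raddf_sum big1 //= => i _.
    by rewrite mcoeffZ mcoeffX -mdeg_eq0 mdeg1 mulr0.
  by rewrite exprS rmorphM /= linform0 mul0r mulr0 mdeg0.
have [i ai] : exists i, a i != 0%N.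
  apply/existsP; apply: contra_notT a_neq0 => /existsPn a0.
  by apply/mnmP => i; rewrite mnm0E; apply/eqP/negbNE/a0.
have -> : a = (a - U_(i) + U_(i))%MM by rewrite submK // lep1mP.
set b := (a - U_(i))%MM.
rewrite mfactU mpowU mdegD mdeg1 addn1 eqSS natrM [_ * (mfact b)%:R]mulrC -mulrA.
rewrite [(_.+1)%:R * _]mulr_natl -mcoeff_mderiv mderiv_exp mderiv_linform mcoeffMn.
rewrite [_ * _%:MP]mulrC mcoeffCM mulrnAr mulrCA IHp.
case: ifP => _; last by rewrite mulr0 mul0rn.
by rewrite factS natrM -mulr_natl -mulrA; congr (_ * _); apply: mulrCA.
Qed.

(** The sum runs over a bounded type of multi-indices whose bound [b] is free,
    so that powers with different exponents can be expanded over one index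
    type before their product is distributed. *)
Lemma linform_exp (C : numClosedFieldType) (d b : nat) (v : 'rV[C]_d) p :
  (p < b)%N ->
  linform v ^+ p =
  \sum_(a : 'X_{1..d < b} | mdeg a == p) (mbinom C a * mpow v a) *: 'X_[a].
Proof.
move=> lt_pb; apply/mpolyP => m; rewrite mcoeff_linform_exp raddf_sum /=.
rewrite (eq_bigr (fun a : 'X_{1..d < b} =>
  if bmnm a == m then mbinom C m * mpow v m else 0)); last first.
  move=> a _; rewrite mcoeffZ mcoeffX; case: eqP => [->|_]; first by rewrite mulr1.
  by rewrite mulr0.
rewrite -big_mkcondr; case: ifP => [deg_m|deg_m].
  have lt_m : (mdeg m < b)%N by rewrite (eqP deg_m).
  rewrite (big_pred1 (BMultinom lt_m)) // => a /=.
  by apply/andP/eqP => [[_ /eqP am]|-> //=]; first exact: val_inj.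
by rewrite big1 // => a /andP[+ /eqP am]; rewrite am deg_m.
Qed.

(** * Rows of the Kronecker power as products of linear forms *)

(** Indices below d^n stand for words of n letters, read in base d with the most
    significant digit first; this puts the letter [a] in front of [j]. The cast
    is there because d^(n+1) does not reduce to d * d^n for a variable n. *)
Definition word_cons {d n : nat} (a : 'I_d) (j : 'I_(d ^ n)) : 'I_(d ^ n.+1) :=
  cast_ord (esym (expnS d n)) (mxtens_index (a, j)).

Lemma big_word (V : nmodType) (d n : nat) (F : 'I_(d ^ n.+1) -> V) :
  \sum_j F j = \sum_(a < d) \sum_(j < d ^ n) F (word_cons a j).
Proof.
rewrite pair_big /= (reindex (fun p => word_cons p.1 p.2)) //=.
exists (fun j => mxtens_unindex (cast_ord (expnS d n) j)) => j _.
  by rewrite /= cast_ordKV mxtens_indexK; case: j.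
by rewrite /word_cons -surjective_pairing mxtens_unindexK cast_ordK.
Qed.

Lemma word_consP {d n : nat} (j : 'I_(d ^ n.+1)) :
  exists a j', j = word_cons a j'.
Proof.
have := mxtens_unindexK (cast_ord (expnS d n) j).
case: mxtens_unindex => a j' E; exists a, j'.
by rewrite /word_cons E cast_ordK.
Qed.

Lemma nu_cons (d n : nat) (a : 'I_d) (j : 'I_(d ^ n)) :
  nu (word_cons a j) = (nu j + U_(a))%MM.
Proof. by rewrite /nu -nu_seqS. Qed.

Lemma ntensmx_cons (R : nzRingType) (d n : nat) (M : 'M[R]_d) (a b : 'I_d)
    (j l : 'I_(d ^ n)) :
  ntensmx M n.+1 (word_cons a j) (word_cons b l) =
  M a b * ntensmx M n j l.
Proof.
case: n j l => [|n] j l; last first.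
  rewrite -tensmxE; congr (ntensmx _ _ _ _); exact: val_inj.
(* The first power is M itself, not the product of M with a 1 x 1 matrix. *)
rewrite !ord1 ntensmx0 mxE eqxx mulr1 ntensmx1.
by congr (M _ _); apply: val_inj; rewrite /= muln1 addn0.
Qed.

(** Putting the letter [a] in front of the row index multiplies both sides by
    the form of row [a] of M: on the left because the new entries are
    M_ab times the old ones while the monomials gain a factor X_b, on the
    right because the exponent of that form grows by one. *)
Lemma ntensmx_linform (R : comNzRingType) (d n : nat) (M : 'M[R]_d)
    (j : 'I_(d ^ n)) :
  \sum_(l < d ^ n) ntensmx M n j l *: 'X_[nu l] =
  \prod_(i < d) linform (row i M) ^+ nu j i.
Proof.
elim: n j => [|n IHn] j.
  rewrite big_ord1 ord1 ntensmx0 mxE eqxx scale1r /nu /= mpolyX0.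
  by rewrite big1 // => i _; rewrite mnm0E expr0.
have [a [{}j ->]] := word_consP j.
rewrite nu_cons big_word.
transitivity (linform (row a M) * \prod_(i < d) linform (row i M) ^+ nu j i).
  rewrite -IHn /linform mulr_suml; apply: eq_bigr => b _.
  rewrite mulr_sumr; apply: eq_bigr => l _.
  by rewrite ntensmx_cons nu_cons mxE -scalerAl -scalerAr scalerA addmC mpolyXD.
rewrite (bigD1 a) //= [in RHS](bigD1 a) //= mnmDE mnm1E eqxx addn1 exprS mulrA.
congr (_ * _); apply: eq_bigr => i /negbTE ia.
by rewrite mnmDE mnm1E eq_sym ia addn0.
Qed.

(** Expanding the power of X_1 + ... + X_d without collecting terms produces
    each word exactly once. *)
Lemma sum_mpolyX_nu (R : comNzRingType) (d n : nat) :
  \sum_(l < d ^ n) 'X_[nu l] = linform (const_mx 1) ^+ n :> {mpoly R[d]}.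
Proof.
elim: n => [|n IHn].
  by rewrite big_ord1 ord1 /nu /= mpolyX0.
rewrite big_word exprS -IHn mulr_suml; apply: eq_bigr => a _.
rewrite mulr_sumr; apply: eq_bigr => l _.
by rewrite nu_cons mpolyXD mxE scale1r mulrC.
Qed.

(** * Entries of the symmetric Kronecker product *)

Lemma mdeg_ell (d n : nat) (i : 'I_(symdim d n)) : (0 < d)%N -> mdeg (ell i) = n.
Proof.
by move=> d_gt0; apply/eqP; rewrite -mem_ell_seq mem_nth // size_ell_seq.
Qed.

(** Both sides are the coefficient of X^k in (X_1 + ... + X_d)^n, where k is
    the multi-index labelled by [i]. *)
Lemma card_sigma (C : numClosedFieldType) (d n : nat) (i : 'I_(symdim d n)) :
  (0 < d)%N ->
  #|sigma i|%:R = n`!%:R / (mfact (ell i))%:R :> C.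
Proof.
move=> d_gt0; transitivity ((\sum_(l < d ^ n) 'X_[nu l] : {mpoly C[d]})@_(ell i)).
  rewrite raddf_sum /= -sum1_card natr_sum big_mkcond /=.
  by apply: eq_bigr => l _; rewrite inE mcoeffX; case: eqP.
rewrite sum_mpolyX_nu mcoeff_linform_exp mdeg_ell // eqxx /mbinom mdeg_ell //.
rewrite [mpow _ _]big1 ?mulr1 // => j _; by rewrite mxE expr1n.
Qed.

Lemma symkron_sigma (C : numClosedFieldType) (d n : nat) (M : 'M[C]_d)
    (i i' : 'I_(symdim d n)) :
  symkron n M i i' =
  (sqrtC #|sigma i|%:R)^-1 * (sqrtC #|sigma i'|%:R)^-1 *
  \sum_(j in sigma i) \sum_(l in sigma i') ntensmx M n j l.
Proof.
have symPE (h : 'I_(symdim d n)) j : symP C d n h j =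
    (sqrtC #|sigma h|%:R)^-1 * (j \in sigma h)%:R.
  rewrite !mxE summxE; congr (_ * _).
  case: (boolP (j \in _)) => jh; last first.
    rewrite big1 // => l lh; rewrite mxE; case: eqP => // jl.
    by rewrite jl lh in jh.
  rewrite (bigD1 j) //= big1 ?addr0 ?mxE ?eqxx // => l /andP[_ lj].
  by rewrite mxE eq_sym (negbTE lj).
rewrite mxE exchange_big [X in _ = _ * X]big_mkcond mulr_sumr; apply: eq_bigr => l _.
rewrite [map_mx _ _ _ _]mxE [_^T _ _]mxE [(_ *m _) _ _]mxE symPE rmorphM fmorphV /=.
rewrite conjC_nat (conj_Creal (x := sqrtC _)); last first.
  by rewrite ger0_real // sqrtC_ge0 ler0n.
case: ifP => _; last by rewrite !mulr0.
rewrite mulr1 mulrAC; congr (_ / _); rewrite mulr_sumr [RHS]big_mkcond /=.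
apply: eq_bigr => j _; rewrite symPE.
by case: ifP => _; rewrite ?mulr1 ?mulr0 ?mul0r.
Qed.

(** The coefficient of X^l in the product of the (linform m_i)^(k_i), where
    m_i are the rows of M, as the multinomial theorem delivers it; [n] only
    bounds the multi-indices and is meant to be the degree of [k]. *)
Definition symcoef {C : numClosedFieldType} {d : nat} (n : nat) (M : 'M[C]_d)
    (k l : 'X_{1..d}) : C :=
  \sum_(alpha : {ffun 'I_d -> 'X_{1..d < n.+1}}
        | [forall j : 'I_d, mdeg (alpha j) == k j]
          && ((\sum_(j < d) (alpha j : 'X_{1..d}))%MM == l))
     (\prod_(j < d) mbinom C (alpha j)) * \prod_(j < d) mpow (row j M) (alpha j).

Lemma mcoeff_prod_linform (C : numClosedFieldType) (d n : nat) (M : 'M[C]_d)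
    (k l : 'X_{1..d}) : mdeg k = n ->
  (\prod_(i < d) linform (row i M) ^+ k i)@_l = symcoef n M k l.
Proof.
move=> deg_k; have le_k i : (k i < n.+1)%N.
  by rewrite ltnS -deg_k mdegE (bigD1 i) //= leq_addr.
under eq_bigr => i _ do rewrite (linform_exp C d n.+1) //.
rewrite bigA_distr_big_dep raddf_sum /symcoef big_mkcondr /=.
apply: eq_big => [alpha|alpha _]; first exact/familyP/forallP.
rewrite scaler_prod -(big_morph _ (@mpolyXD _ _) (@mpolyX0 _ _)).
rewrite mcoeffZ mcoeffX big_split /=.
by case: eqP => _; rewrite ?mulr1 ?mulr0.
Qed.

(** The inner sum of [symkron_sigma] is the coefficient of X^l in a polynomial
    that is the same for every row j in sigma(k), so the outer sum multiplies
    it by #sigma(k). *)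
Lemma symkronE (C : numClosedFieldType) (d n : nat) (M : 'M[C]_d)
    (i i' : 'I_(symdim d n)) : (0 < d)%N ->
  symkron n M i i' =
  (sqrtC (mfact (ell i))%:R)^-1 * sqrtC (mfact (ell i'))%:R
  * symcoef n M (ell i) (ell i').
Proof.
move=> d_gt0; rewrite symkron_sigma.
have colsum j : j \in sigma i ->
    \sum_(l in sigma i') ntensmx M n j l = symcoef n M (ell i) (ell i').
  rewrite inE => /eqP nu_j; rewrite -mcoeff_prod_linform ?mdeg_ell // -nu_j.
  rewrite -ntensmx_linform raddf_sum big_mkcond /=; apply: eq_bigr => l _.
  by rewrite inE mcoeffZ mcoeffX; case: eqP => _; rewrite ?mulr1 ?mulr0.
rewrite (eq_bigr _ colsum) sumr_const -[symcoef _ _ _ _ *+ _]mulr_natl mulrA.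
congr (_ * _).
have sqrt_neq0 (c : nat) : (0 < c)%N -> sqrtC c%:R != 0 :> C.
  by move=> c_gt0; rewrite sqrtC_eq0 pnatr_eq0 -lt0n.
have sqrt_card (h : 'I_(symdim d n)) : sqrtC #|sigma h|%:R =
    sqrtC n`!%:R / sqrtC (mfact (ell h))%:R :> C.
  by rewrite card_sigma // sqrtCM ?rootCV ?nnegrE ?invr_ge0 ?ler0n.
rewrite -[#|sigma i|%:R in X in _ * X]sqrtCK !sqrt_card.
by field; rewrite !sqrt_neq0 ?mfact_gt0 ?fact_gt0.
Qed.

Theorem theorem1 (R : realType) (d n : nat) (hd : (1 <= d)%N) (M : 'M[R[i]]_d)
    (y : 'cV[R[i]]_(symdim d n)) (k : 'X_{1..d}) (hk : mdeg k = n) :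
  mcomp (symkron n M *m y) k =
  (sqrtC (mfact k)%:R)^-1 *
  \sum_(alpha : {ffun 'I_d -> 'X_{1..d < n.+1}}
        | [forall j : 'I_d, mdeg (alpha j) == k j])
     (\prod_(j < d) mbinom R[i] (alpha j)) *
     (\prod_(j < d) mpow (row j M) (alpha j)) *
     sqrtC (mfact (\sum_(j < d) (alpha j : 'X_{1..d}))%MM)%:R *
     mcomp y (\sum_(j < d) (alpha j : 'X_{1..d}))%MM.
Proof.
have [i <-] := ell_surj hd hk.
rewrite mcomp_ell // mxE.
pose G i' := sqrtC (mfact (ell i'))%:R * y i' 0.
transitivity ((sqrtC (mfact (ell i))%:R)^-1 *
    \sum_i' symcoef n M (ell i) (ell i') * G i').
  rewrite mulr_sumr; apply: eq_bigr => i' _.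
  by rewrite symkronE // /G -!mulrA; congr (_ * _); rewrite mulrCA.
(* Each family alpha occurs for exactly one column index, the label of its
   total, so exchanging the two sums collapses the sum over columns. *)
congr (_ * _); under eq_bigr => i' _ do rewrite /symcoef mulr_suml big_mkcondr.
rewrite exchange_big /=; apply: eq_bigr => alpha /forallP deg_alpha.
have deg_sum : mdeg (\sum_(j < d) (alpha j : 'X_{1..d}))%MM = n.
  rewrite mdeg_sum; apply: etrans (mdeg_ell d n i hd); rewrite [RHS]mdegE.
  by apply: eq_bigr => j _; apply/eqP/deg_alpha.
have [i' ell_i'] := ell_surj hd deg_sum.
rewrite -ell_i' mcomp_ell // (bigD1 i') //= eqxx.
rewrite [X in _ + X]big1 ?addr0 ?mulrA // => h hi'.
by rewrite (inj_eq (ell_inj hd)) eq_sym (negbTE hi').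
Qed.
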